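(* Let $\{(X_i,\mathcal U_i):i\in I\}$ be a family of $g$-quasi uniform spaces with $I\neq\emptyset$, and let $(X,\mathcal U)$ be its product $g$-quasi uniform space. If $(X,\mathcal U)$ is Lebesgue, then $(X_i,\mathcal U_i)$ is Lebesgue for each $i\in I$.
   Context: A $g$-quasi uniformity (generalized quasi-uniformity) on a nonempty set $Z$ is a nonempty collection $\mathcal V\subset\mathcal P(Z\times Z)$ such that (i) $\Delta(Z)=\{(z,z):z\in Z\}\subset U$ for all $U\in\mathcal V$; (ii) $U\in\mathcal V$ and $U\subset V\subset Z\times Z$ imply $V\in\mathcal V$; (iii) for each $U\in\mathcal V$ there is $V\in\mathcal V$ with $V\circ V\subset U$, where $V\circ V=\{(x,z):\exists y,\ (x,y)\in V,(y,z)\in V\}$. (Closure under intersection is not required.) The pair $(Z,\mathcal V)$ is called a $g$-quasi uniform space. Product: for a family $\{(X_i,\mathcal U_i):i\in I\}$ of $g$-quasi uniform spaces, let $X=\prod_{i\in I}X_i$ with projections $\pi_i:X\to X_i$. The product $g$-quasi uniformity $\mathcal U$ on $X$ is the one with base $\{(\pi_i\times\pi_i)^{-1}(U_i):U_i\in\mathcal U_i,\ i\in I\}$, i.e. $\mathcal U=\{V\subset X\times X: (\pi_i\times\pi_i)^{-1}(U_i)\subset V\text{ for some }i\in I,\ U_i\in\mathcal U_i\}$ (no finite intersections are taken). $(X,\mathcal U)$ is the product $g$-quasi uniform space. For $U\in\mathcal V$ and $x\in Z$ put $U(x)=\{y\in Z:(x,y)\in U\}$. The collection $\mu(\mathcal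 V)=\{G\subset Z: \text{for every }x\in G\text{ there is }U\in\mathcal V\text{ with }U(x)\subset G\}$ is the induced supratopology. A generalized neighborhood of $a\in Z$ is a set $A\subset Z$ with $a\in G\subset A$ for some $G\in\mu(\mathcal V)$. A net $(S_n)_{n\in D}$ in $Z$ is a map from a directed set $(D,\ge)$ to $Z$. A point $c\in Z$ is a cluster point of the net if for every generalized neighborhood $A$ of $c$ and every $n\in D$ there is $m\in D$ with $m\ge n$ and $S_m\in A$. The net is pseudo-Cauchy if for every $U\in\mathcal V$ and $p\in D$ there exist $m,n\in D$ with $m\neq n$, $m,n\ge p$ and $(S_m,S_n)\in U$. $(Z,\mathcal V)$ is Lebesgue if every pseudo-Cauchy net $(S_n)_{n\in D}$ in $Z$ having distinct terms (i.e. $S_m\ne S_n$ for all $m\ne n$) has a cluster point in $Z$. *)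

(* Defs.v *)
From mathcomp Require Import all_boot.
From mathcomp Require Import mathcomp_extra boolp classical_sets.

Set Implicit Arguments.
Unset Strict Implicit.
Unset Printing Implicit Defensive.

Local Open Scope classical_set_scope.

Record g_quasi_uniformity (Z : Type) (V : set (set (Z * Z))) : Prop := {
  gqu_carrier : [set: Z] !=set0;
  gqu_nonempty : V !=set0;
  gqu_diagonal : forall A, V A -> diagonal `<=` A;
  gqu_upward : forall A B, V A -> A `<=` B -> V B;
  gqu_split : forall A, V A -> exists2 B, V B & (B \; B)%relation `<=` A
}.

(* A single index suffices: unlike for uniformities, no finite intersections
   are taken. *)
Definition product_gqu (I : Type) (X : I -> Type)
    (U : forall i, set (set (X i * X i))) :
    set (set ((forall i, X i) * (forall i, X i))) :=
  [set V | exists i, exists2 Ui : set (X i * X i), U i Ui &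
     (fun xy => (proj i xy.1, proj i xy.2)) @^-1` Ui `<=` V].

Lemma product_gquP (I : Type) (X : I -> Type)
    (U : forall i, set (set (X i * X i))) :
  inhabited I -> (forall i, g_quasi_uniformity (U i)) ->
  g_quasi_uniformity (product_gqu U).
Proof.
move=> [i0] gU; split.
- have [f _] : {f : forall i, X i | True}.
    apply: cid; have h i : {x : X i | [set: X i] x}.
      exact/cid/(gqu_carrier (gU i)).
    by exists (fun i => sval (h i)).
  by exists f.
- have [A UA] := gqu_nonempty (gU i0).
  by exists ((fun xy => (proj i0 xy.1, proj i0 xy.2)) @^-1` A); exists i0, A.
- move=> V [i [A UA AV]] [x y] /= xy; apply: AV => /=.
  by apply: (gqu_diagonal (gU i) UA); rewrite /diagonal /=; congr (proj i _).
- by move=> V W [i [A UA AV]] VW; exists i, A => //; exact: subset_trans VW.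
- move=> V [i [A UA AV]]; have [B UB BA] := gqu_split (gU i) UA.
  exists ((fun xy => (proj i xy.1, proj i xy.2)) @^-1` B); first by exists i, B.
  move=> [x z] [y /= xy yz]; apply: AV; apply: BA.
  by exists (proj i y).
Qed.

Definition supratopology (Z : Type) (V : set (set (Z * Z))) : set (set Z) :=
  [set G | forall x, G x -> exists2 A, V A & xsection A x `<=` G].

Definition gen_nbhs (Z : Type) (V : set (set (Z * Z))) (a : Z) : set (set Z) :=
  [set A | exists2 G, supratopology V G & G a /\ G `<=` A].

(* ge is a preorder: antisymmetry is not part of the notion of directed set. *)
Record directed_set (D : Type) (ge : D -> D -> Prop) : Prop := {
  directed_nonempty : [set: D] !=set0;
  directed_refl : forall n, ge n n;
  directed_trans : forall m n p, ge m n -> ge n p -> ge m p;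
  directed_bound : forall m n, exists2 p, ge p m & ge p n
}.

Definition net_cluster_point (Z : Type) (V : set (set (Z * Z)))
    (D : Type) (ge : D -> D -> Prop) (S : D -> Z) (c : Z) : Prop :=
  forall A, gen_nbhs V c A -> forall n, exists2 m, ge m n & A (S m).

Definition pseudo_cauchy (Z : Type) (V : set (set (Z * Z)))
    (D : Type) (ge : D -> D -> Prop) (S : D -> Z) : Prop :=
  forall A, V A -> forall p,
    exists m n, [/\ m <> n, ge m p, ge n p & A (S m, S n)].

Definition lebesgue (Z : Type) (V : set (set (Z * Z))) : Prop :=
  forall (D : Type) (ge : D -> D -> Prop) (S : D -> Z),
    directed_set ge ->
    pseudo_cauchy V ge S ->
    (forall m n, m <> n -> S m <> S n) ->
    exists c, net_cluster_point V ge S c.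

(* Main.v *)
Require Import Defs.
From mathcomp Require Import all_boot.
From mathcomp Require Import mathcomp_extra boolp classical_sets.

(** Each factor embeds in the product as a slice: fix a point [b] of the
    product and let only the [i]-th coordinate vary.  A net [S] in the factor
    [X i] thus becomes a net in the product, injective when [S] is.  A basic
    entourage of the product constrains a single coordinate [j].  When [j] is
    [i] the lifted net meets the constraint as often as [S] does; when [j] is
    another index the lifted net is constant in that coordinate, and the
    diagonal axiom makes the constraint vacuous.  So the lifted net is
    pseudo-Cauchy ([pseudo_cauchy_slice]), and the Lebesgue property of the
    product gives it a cluster point [c].  Projections are continuous for the
    induced supratopologies ([supratopology_preimage_proj]), hence carry
    cluster points to cluster points ([net_cluster_point_proj]), and [c i] is
    the cluster point required of [S]. *)

Local Open Scope classical_set_scope.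

Section Product.
Variables (I : Type) (X : I -> Type) (U : forall i, set (set (X i * X i))).

(** Indices are compared through [{classic I}], which equips an arbitrary type
    with a decidable equality. *)
Definition slice (b : forall j, X j) (i : I) (x : X i) : forall j, X j :=
  @dfwith {classic I} X b i x.

Lemma slice_in b i x : slice b i x i = x.
Proof. exact: (@dfwithin {classic I}). Qed.

Lemma slice_out b i x j : i <> j -> slice b i x j = b j.
Proof. by move=> ij; apply: (@dfwithout {classic I}); apply/eqP. Qed.

Lemma supratopology_preimage_proj i (G : set (X i)) :
  supratopology (U i) G -> supratopology (product_gqu U) (proj i @^-1` G).
Proof.
move=> openG x Gx; have [A UA AG] := openG _ Gx.
exists ((fun xy => (proj i xy.1, proj i xy.2)) @^-1` A); first by exists i, A.
by move=> y /xsectionP Axy; apply: AG; apply/xsectionP.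
Qed.

Lemma net_cluster_point_proj i (D : Type) (ge : D -> D -> Prop)
    (T : D -> forall j, X j) (c : forall j, X j) :
  net_cluster_point (product_gqu U) ge T c ->
  net_cluster_point (U i) ge (fun n => T n i) (c i).
Proof.
move=> clT A [G openG [Gc GA]] n.
have nbhs_c : gen_nbhs (product_gqu U) c (proj i @^-1` G).
  by exists (proj i @^-1` G); [exact: supratopology_preimage_proj | split].
have [m mn Gm] := clT _ nbhs_c n.
by exists m => //; apply: GA.
Qed.

(** In a coordinate other than [i] every pair of terms satisfies the
    constraint, but two distinct indices beyond [p] are still to be found: the
    pseudo-Cauchy property of [S], applied to any entourage of [U i],
    supplies them. *)
Lemma pseudo_cauchy_slice (U_gqu : forall j, g_quasi_uniformity (U j)) b i
    (D : Type) (ge : D -> D -> Prop) (S : D -> X i) :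
  pseudo_cauchy (U i) ge S ->
  pseudo_cauchy (product_gqu U) ge (fun n => slice b i (S n)).
Proof.
move=> cauchyS V [j [A UA AV]] p.
have [ij|ij] := pselect (i = j).
  subst j; have [m [n [mn mp np ASmn]]] := cauchyS _ UA p.
  exists m, n; split=> //; apply: AV.
  by rewrite /= /proj !slice_in.
have [B UB] := gqu_nonempty (U_gqu i).
have [m [n [mn mp np _]]] := cauchyS _ UB p.
exists m, n; split=> //; apply: AV; apply: (gqu_diagonal (U_gqu j) UA).
by rewrite /diagonal /= /proj !slice_out.
Qed.

End Product.

Theorem theorem4p6 (I : Type) (X : I -> Type)
    (U : forall i : I, set (set (X i * X i)))
    (I_nonempty : inhabited I)
    (U_gqu : forall i : I, g_quasi_uniformity (U i))
    (product_lebesgue : lebesgue (product_gqu U)) :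
  forall i : I, lebesgue (U i).
Proof.
move=> i D ge S dirD cauchyS injS.
have [b _] := gqu_carrier (product_gquP I_nonempty U_gqu).
have [|m n mn eqT|c clc] :=
  product_lebesgue D ge (fun n => slice I X b i (S n)) dirD.
- exact: pseudo_cauchy_slice.
- by apply: (injS _ _ mn); rewrite -(slice_in _ _ b i (S m)) eqT slice_in.
- exists (c i); move: (net_cluster_point_proj _ _ _ i _ _ _ _ clc).
  by congr (net_cluster_point _ _ _ _); apply: funext => n; rewrite slice_in.
Qed.
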